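(* Let $V\in\mathcal K$. If $V$ has the modified distal Kato property $$\lim_{R\to\infty}\ \sup_{y\in\mathbb R^3}\int_{|x|>R}\frac{|V(x)|\,dx}{|x-y|}=0,$$ then $V$ has the distal Kato property $$\lim_{R\to\infty}\ \sup_{y\in\mathbb R^3}\int_{|x-y|>R}\frac{|V(x)|\,dx}{|x-y|}=0.$$
   Context: The global Kato class $\mathcal K$ consists of the (possibly singular) measures $V$ on $\mathbb R^3$ of locally bounded variation for which $\|V\|_{\mathcal K}=\sup_{y\in\mathbb R^3}\int_{\mathbb R^3}\frac{d|V|(x)}{|x-y|}<\infty$; one writes $|V(x)|\,dx$ for $d|V|(x)$, where $|V|$ is the total variation measure. Functions are identified with absolutely continuous measures. *)

(* Defs.v *)
From HB Require Import structures.
From mathcomp Require Import all_boot all_order all_algebra.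
From mathcomp Require Import complex.
From mathcomp Require Import all_classical all_reals all_analysis.

Set Implicit Arguments.
Unset Strict Implicit.
Unset Printing Implicit Defensive.

Import Order.TTheory GRing.Theory Num.Theory.
Import numFieldNormedType.Exports.
Import ComplexField.Normc.

Local Open Scope classical_set_scope.
Local Open Scope ring_scope.

(* R^3 with its Borel sigma-algebra; convertible to 'rV[R]_3. *)
Notation borel3 R := (g_sigma_algebraType (@open 'rV[R]_3)).

(* The Euclidean distance; the library norm on 'rV[R]_3 is the sup norm. *)
Definition eucl_dist (R : realType) (x y : 'rV[R]_3) : R :=
  Num.sqrt (\sum_(i < 3) (x ord0 i - y ord0 i) ^+ 2).

Definition bounded_borel (R : realType) (A : set (borel3 R)) : Prop :=
  measurable A /\ bounded_set (A : set 'rV[R]_3).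

(* The total variation of a set function that is only meaningful on the bounded
   Borel sets: the pieces are therefore bounded, and need not cover A. *)
Definition set_variation (R : realType) (V : set (borel3 R) -> R[i])
    (A : set (borel3 R)) : \bar R :=
  ereal_sup [set s | exists n (B : 'I_n -> set (borel3 R)),
    [/\ forall i, bounded_borel (B i), forall i, B i `<=` A,
        trivIset [set: 'I_n] B & s = (\sum_(i < n) normc (V (B i)))%:E]].

(* Complex (in particular, signed) measures of locally bounded variation on R^3.
   V A is only meaningful for A Borel and bounded: the value on an unbounded set
   need not exist, as both the positive and the negative part may be infinite. *)
Record lbv_measure (R : realType) := LbvMeasure {
  lbv_fun :> set (borel3 R) -> R[i] ;
  lbv_set0 : lbv_fun set0 = 0 ;
  lbv_sigma_additive : forall F : nat -> set (borel3 R),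
    (forall k, measurable (F k)) -> trivIset [set: nat] F ->
    bounded_borel (\bigcup_k F k) ->
    (fun n => \sum_(0 <= k < n) lbv_fun (F k) : R[i]^o) @ \oo
      --> (lbv_fun (\bigcup_k F k) : R[i]^o) ;
  lbv_bounded_variation : forall A, bounded_borel A ->
    (set_variation lbv_fun A < +oo)%E }.

Section set_variation_measure.
Context (R : realType).
Variable V : lbv_measure R.
Local Notation T := (borel3 R).
Implicit Types A B : set T.

Let bounded_borelI A B :
  bounded_borel A -> measurable B -> bounded_borel (A `&` B).
Proof.
move=> [mA bA] mB; split; first exact: measurableI.
case: bA => M [Mr bA]; exists M; split=> // x Mx y [Ay _]; exact: bA Ay.
Qed.

Let set_variation0 : set_variation V set0 = 0%E.
Proof.
apply/eqP; rewrite eq_le; apply/andP; split.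
  apply: ge_ereal_sup => _ [n [B [_ B0 _ ->]]].
  rewrite lee_fin big1// => i _.
  by rewrite (_ : B i = set0) ?lbv_set0 ?normc0//; apply/seteqP; split.
apply: ereal_sup_ubound; exists 0%N, (fun=> set0).
by split; [case|case|case|rewrite big_ord0].
Qed.

Let set_variation_ge0 A : (0 <= set_variation V A)%E.
Proof.
apply: ereal_sup_ubound; exists 0%N, (fun=> set0).
by split; [case|case|case|rewrite big_ord0].
Qed.

Let le_set_variation A B :
  A `<=` B -> (set_variation V A <= set_variation V B)%E.
Proof.
move=> AB; apply: le_ereal_sup => _ [n [C [mC CA tC ->]]].
by exists n, C; split=> // i; apply: subset_trans AB.
Qed.

Let set_variationU A B : A `&` B = set0 ->
  (set_variation V A + set_variation V B <=
   set_variation V (A `|` B))%E.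
Proof.
move=> AB0.
have step n (C : 'I_n -> set T) m (D : 'I_m -> set T) :
    (forall i, bounded_borel (C i)) -> (forall i, C i `<=` A) ->
    trivIset [set: 'I_n] C ->
    (forall i, bounded_borel (D i)) -> (forall i, D i `<=` B) ->
    trivIset [set: 'I_m] D ->
    ((\sum_(i < n) normc (V (C i)))%:E + (\sum_(i < m) normc (V (D i)))%:E <=
     set_variation V (A `|` B))%E.
  move=> mC CA tC mD DB tD; apply: ereal_sup_ubound.
  pose G (i : 'I_(n + m)) :=
    match fintype.split i with inl j => C j | inr k => D k end.
  exists (n + m)%N, G; split.
  - by move=> i; rewrite /G; case: (fintype.split i).
  - move=> i; rewrite /G; case: (fintype.split i) => j x Gx.
      by left; exact: CA Gx.
    by right; exact: DB Gx.
  - move=> i j _ _; rewrite /G => -[x [hi hj]].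
    rewrite -(splitK i) -(splitK j); move: hi hj.
    case: (fintype.split i) => a; case: (fintype.split j) => b /= h1 h2.
    + by congr (unsplit (inl _)); apply: tC => //; exists x.
    + by suff : set0 x by []; rewrite -AB0; split; [exact: CA h1|exact: DB h2].
    + by suff : set0 x by []; rewrite -AB0; split; [exact: CA h2|exact: DB h1].
    + by congr (unsplit (inr _)); apply: tD => //; exists x.
  - rewrite -EFinD big_split_ord/=; congr (_ + _)%:E; apply: eq_bigr => i _.
      by rewrite /G -[lshift _ _]/(unsplit (inl i)) unsplitK.
    by rewrite /G -[rshift _ _]/(unsplit (inr i)) unsplitK.
have [->|fin] := eqVneq (set_variation V (A `|` B)) +oo%E.
  by rewrite leey.
have finAB C : C `<=` A `|` B -> set_variation V C \is a fin_num.
  move=> CAB; rewrite ge0_fin_numE//.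
  by apply: le_lt_trans (le_set_variation CAB) _; rewrite ltey.
rewrite -leeBrDr; last by apply: finAB; exact: subsetUr.
apply: ge_ereal_sup => _ [n [C [mC CA tC ->]]].
rewrite leeBrDr; last by apply: finAB; exact: subsetUr.
rewrite addeC -leeBrDr//.
apply: ge_ereal_sup => _ [m [D [mD DB tD ->]]].
rewrite leeBrDr// addeC; exact: step.
Qed.

Let set_variation_semi_sigma_additive :
  semi_sigma_additive (set_variation V).
Proof.
move=> F mF tF mUF.
have cvgF := @is_cvg_nneseries _ (fun k => set_variation V (F k))
  predT 0%N (fun k _ _ => set_variation_ge0 (F k)).
suff -> : set_variation V (\bigcup_k F k) =
    (\sum_(0 <= k <oo) set_variation V (F k))%E by [].
apply/eqP; rewrite eq_le; apply/andP; split; last first.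
  apply: lime_le => //; apply: nearW => n.
  have : (\sum_(0 <= k < n) set_variation V (F k) <=
      set_variation V (\big[setU/set0]_(k < n) F k))%E.
    elim: n => [|n ih]; first by rewrite big_nil big_ord0 set_variation0.
    rewrite big_nat_recr//= big_ord_recr/=.
    apply: le_trans (set_variationU _); first by rewrite leeD2r.
      rewrite -bigcup_mkord; apply/seteqP; split=> // x [[k /= kn Fk] Fn].
    by have kE := tF k n I I (ex_intro _ x (conj Fk Fn)); rewrite kE ltnn in kn.
  move=> /le_trans; apply; apply: le_set_variation.
  exact: bigsetU_bigcup.
apply: ge_ereal_sup => _ [n [B [mB BF tB ->]]].
pose u N : R := \sum_(j < n) normc (\sum_(0 <= k < N) V (B j `&` F k)).
have bigcupB j : \bigcup_k (B j `&` F k) = B j.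
  by rewrite -setI_bigcupr; apply/setIidPl/BF.
have ucvg : u @ \oo --> \sum_(j < n) normc (V (B j)).
  apply: cvg_big => [|j _]; first exact: add_continuous.
  have := @lbv_sigma_additive _ V (fun k => B j `&` F k).
  move=> /(_ (fun k => measurableI _ _ (mB j).1 (mF k))).
  rewrite bigcupB => /(_ _ (mB j)) Vj.
  have {}Vj := Vj (trivIset_setIl tF).
  apply/cvgrPdist_lt => e e0.
  have eC0 : 0 < e%:C%C :> R[i] by rewrite ltcR.
  have /cvgrPdist_lt/(_ _ eC0) := Vj.
  apply: filterS => N; rewrite [X in X < _ -> _]normc_def ltcR => /(le_lt_trans _); apply.
  set a := V (B j); set b := \sum_(_ <= _ < _) _.
  have -> : Num.sqrt (complex.Re (a - b) ^+ 2 + complex.Im (a - b) ^+ 2) =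
            normc (a - b) by case: (a - b).
  rewrite ler_norml; apply/andP; split.
    rewrite lerNl opprB lerBlDr -(normcN (a - b)) opprB.
    by rewrite (le_trans _ (le_normcD _ _)) // subrK.
  by rewrite lerBlDr (le_trans _ (le_normcD _ _)) // subrK.
suff uS N : ((u N)%:E <= \sum_(0 <= k <oo) set_variation V (F k))%E.
  move: uS; case: (\sum_(0 <= k <oo) _)%E => [s| |] uS; last 2 first.
  - by rewrite leey.
  - by have := uS 0%N; rewrite leeNy_eq.
  rewrite lee_fin -(cvg_lim (@Rhausdorff R) ucvg); apply: limr_le.
    by apply/cvg_ex; eexists; exact: ucvg.
  by apply: nearW => N; rewrite -lee_fin.
apply: le_trans (nneseries_lim_ge N _) => //.
apply: (@le_trans _ _ (\sum_(0 <= k < N) (\sum_(j < n) normc (V (B j `&` F k)))%:E)%E).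
  rewrite sumEFin lee_fin exchange_big/=; apply: ler_sum => j _.
  elim/big_ind2 : _ => //; first by rewrite normc0.
  by move=> x y z t xy zt; rewrite (le_trans (le_normcD _ _))// lerD.
apply: lee_sum => k _; apply: ereal_sup_ubound.
exists n, (fun j => B j `&` F k); split => //.
- by move=> j; apply: bounded_borelI.
- by apply: trivIset_setIr.
Qed.

HB.instance Definition _ := isMeasure.Build _ T R (set_variation V)
  set_variation0 set_variation_ge0 set_variation_semi_sigma_additive.

End set_variation_measure.

Section kato.
Context (R : realType).
Variable V : lbv_measure R.
Local Open Scope ereal_scope.

(* The inverse is that of \bar R, for which 0^-1 = +oo. *)
Definition kato_norm : \bar R :=
  ereal_sup (range (fun y : 'rV[R]_3 =>
    \int[set_variation V]_x ((eucl_dist x y)%:E)^-1)).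

Definition kato_class : Prop := kato_norm < +oo.

Definition modified_distal_kato : Prop :=
  ereal_sup (range (fun y : 'rV[R]_3 =>
    \int[set_variation V]_(x in [set x | (r < eucl_dist x 0)%R])
      ((eucl_dist x y)%:E)^-1)) @[r --> +oo%R] --> 0.

Definition distal_kato : Prop :=
  ereal_sup (range (fun y : 'rV[R]_3 =>
    \int[set_variation V]_(x in [set x | (r < eucl_dist x y)%R])
      ((eucl_dist x y)%:E)^-1)) @[r --> +oo%R] --> 0.

End kato.

(* Main.v *)
(* Splitting {|x - y| > s} along the fixed ball {|x| <= r} gives
     int_{|x-y|>s} d|V|/|x-y| <= int_{|x|>r} d|V|/|x-y| + |V|({|x| <= r}) / s.
   The first term is small uniformly in y for large r; with r fixed, the ball has
   finite variation, so the second one tends to 0 as s goes to infinity. *)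
Require Import Defs.
From mathcomp Require Import all_boot all_order all_algebra.
From mathcomp Require Import all_classical all_reals all_analysis.
From mathcomp Require Import measurable_realfun.

Import Order.TTheory GRing.Theory Num.Theory.
Import numFieldNormedType.Exports.

Local Open Scope classical_set_scope.
Local Open Scope ring_scope.

Lemma eucl_dist_ge0 (R : realType) (x y : 'rV[R]_3) : 0 <= eucl_dist x y.
Proof. exact: sqrtr_ge0. Qed.

Lemma continuous_eucl_dist (R : realType) (y : 'rV[R]_3) :
  continuous (fun x : 'rV[R]_3 => eucl_dist x y).
Proof.
move=> x; apply: continuous_comp; last exact: sqrt_continuous.
apply: (@cvg_big _ _ _ _ _ _ _ (nbhs x)) => [|i _]; first exact: add_continuous.
have xyi : (z ord0 i - y ord0 i) @[z --> x] --> x ord0 i - y ord0 i.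
  by apply: (@cvgB _ _ _ (nbhs x)); [exact: (@coord_continuous R 1 3 ord0 i x)|exact: cvg_cst].
by rewrite expr2; under eq_fun do rewrite expr2; exact: cvgM.
Qed.

Lemma measurable_eucl_dist_gt (R : realType) (y : 'rV[R]_3) (r : R) :
  measurable ([set x | r < eucl_dist x y] : set (borel3 R)).
Proof.
apply: sub_sigma_algebra; apply: (open_comp _ (@open_gt _ r)) => x _.
exact: continuous_eucl_dist.
Qed.

(* Since 1 / 0 = +oo, [1 / d] exceeds [a] exactly when [a * d < 1], for every
   real [a] and every [d >= 0]. *)
Lemma measurable_inv_eucl_dist (R : realType) (y : 'rV[R]_3)
    (D : set (borel3 R)) :
  measurable_fun D (fun x : borel3 R => (eucl_dist x y)%:E^-1)%E.
Proof.
apply: measurable_funTS.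
apply: (measurability _ (ErealGenOInfty.measurableE R)).
move=> /= _ [_ [a ->]] <-; rewrite setTI preimage_itvoy.
rewrite (_ : [set _ | _] = [set x | a * eucl_dist x y < 1]).
  apply: sub_sigma_algebra; apply: (open_comp _ (@open_lt _ 1)) => x _.
  apply: (@continuous_comp _ _ _ (fun z => eucl_dist z y) ( *%R a)).
    exact: continuous_eucl_dist.
  exact: mulrl_continuous.
apply/seteqP; split => x /=; rewrite inver;
  (have [->|d0] := eqVneq (eucl_dist x y) 0; first by rewrite mulr0 ltr01 ltry).
all: by rewrite lte_fin -[_^-1]mul1r ltr_pdivlMr// lt_def d0 eucl_dist_ge0.
Qed.

(** Boundedness refers to the sup norm, which the Euclidean norm dominates: each squared coordinate
    is one term of the sum of squares. This gives access to [lbv_bounded_variation] on balls. *)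
Lemma bounded_borel_eucl_ball (R : realType) (y : 'rV[R]_3) (r : R) :
  bounded_borel (~` [set x | r < eucl_dist x y] : set (borel3 R)).
Proof.
split; first by apply: measurableC; exact: measurable_eucl_dist_gt.
(* Triangle inequality for [x = (x - y) + y]. The absolute value of [r] keeps the bound nonnegative,
   as a maximum starting from 0 requires. *)
exists (`|y| + `|r|); split; first exact: num_real.
move=> M yrM x /= /negP; rewrite -leNgt => xyr.
apply: le_trans (ltW yrM); rewrite -[x](subrK y).
apply: le_trans (ler_normD _ _) _; rewrite addrC lerD2l.
rewrite [leLHS]mx_normrE; apply: bigmax_le => // -[i j] _ /=.
apply: le_trans (le_trans xyr (ler_norm r)).
rewrite -sqrtr_sqr ler_sqrt ?sumr_ge0// => [|k _]; last exact: sqr_ge0.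
rewrite (bigD1 j)//= !mxE (ord1 i) lerDl.
by apply: sumr_ge0 => k _; exact: sqr_ge0.
Qed.

(** Turns a limit in [\bar R] into eventual upper bounds, so that suprema that might be infinite
    need no separate finiteness argument. *)
Lemma ge0_cvge0P (R : realType) (T : Type) (F : set_system T)
    (f : T -> \bar R) : Filter F -> (forall x, 0 <= f x)%E ->
  f @ F --> 0%E <-> forall e : R, 0 < e -> \forall x \near F, (f x <= e%:E)%E.
Proof.
move=> FF f0; split=> [/fine_cvgP[ffin /cvgrPdist_le f_0] e e0|fe].
  have := f_0 _ e0; apply: filterS2 ffin => x fx.
  by rewrite sub0r normrN ger0_norm ?fine_ge0//= -lee_fin fineK.
apply/fine_cvgP; split.
  (* Any fixed bound, here 1, gives eventual finiteness. *)
  apply: filterS (fe 1 ltr01) => x fx1; rewrite ge0_fin_numE//.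
  by rewrite (le_lt_trans fx1) ?ltry.
apply/cvgrPdist_le => e e0; apply: filterS (fe e e0) => x fxe.
rewrite sub0r normrN ger0_norm ?fine_ge0//= -lee_fin fineK//.
by rewrite ge0_fin_numE// (le_lt_trans fxe) ?ltry.
Qed.

Lemma integral_inv_eucl_dist_le (R : realType) (V : lbv_measure R)
    (y : 'rV[R]_3) (r s : R) : 0 < s ->
  (\int[set_variation V]_(x in [set x | (s < eucl_dist x y)%R])
      ((eucl_dist x y)%:E)^-1 <=
   \int[set_variation V]_(x in [set x | (r < eucl_dist x 0)%R])
      ((eucl_dist x y)%:E)^-1 +
   (s^-1)%:E * set_variation V (~` [set x | (r < eucl_dist x 0)%R]))%E.
Proof.
move=> s0.
set A := [set x | (s < eucl_dist x y)%R]; set B := [set x | (r < _)%R].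
have mA : measurable (A : set (borel3 R)) by exact: measurable_eucl_dist_gt.
have mB : measurable (B : set (borel3 R)) by exact: measurable_eucl_dist_gt.
have mf D := @measurable_inv_eucl_dist R y D.
have f0 (x : borel3 R) : (0 <= (eucl_dist x y)%:E^-1)%E.
  by rewrite inve_ge0 lee_fin eucl_dist_ge0.
have mAB := measurableI _ _ mA mB.
have mACB := measurableI _ _ mA (measurableC mB).
rewrite -[X in (integral _ X _ <= _)%E](setUIDK A B).
rewrite ge0_integral_setU//; last first.
  by apply/disj_setPS => x [[_ Bx] [_ /(_ Bx)]].
(* On [A] inside [B] the integrand is kept and the domain enlarged to [B]. *)
apply: leeD; first by apply: ge0_subset_integral => // x [].
(* Off [B] the cutoff [s < eucl_dist x y] keeps [x] away from the pole, so the integrand is at most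
   [s^-1]. *)
apply: (@le_trans _ _ (\int[set_variation V]_(x in A `\` B) cst (s^-1)%:E x)%E).
  apply: ge0_le_integral => //= x [/= sx _].
  have d0 : 0 < eucl_dist x y := lt_trans s0 sx.
  by rewrite inver gt_eqF// lee_fin lef_pV2 ?posrE// ltW.
rewrite integral_cst//; apply: lee_wpmul2l; first by rewrite lee_fin invr_ge0 ltW.
by apply: le_measure; rewrite ?inE//; exact: measurableC.
Qed.

Theorem lemma1p5 (R : realType) (V : lbv_measure R)
    (hV : kato_class V) (hmod : modified_distal_kato V) :
  distal_kato V.
Proof.
have int_ge0 (y : 'rV[R]_3) (D : set (borel3 R)) :
    (0 <= \int[set_variation V]_(x in D) ((eucl_dist x y)%:E)^-1)%E.
  by apply: integral_ge0 => x _; rewrite inve_ge0 lee_fin eucl_dist_ge0.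
(* The domain may depend on [y]: a constant [D] serves the hypothesis, a moving one the
   conclusion. *)
have sup_ge0 (D : 'rV[R]_3 -> set (borel3 R)) :
    (0 <= ereal_sup (range (fun y : 'rV[R]_3 =>
      \int[set_variation V]_(x in D y) ((eucl_dist x y)%:E)^-1)))%E.
  by apply: (le_trans (int_ge0 0 (D 0))); apply: ereal_sup_ubound; exists 0.
apply/ge0_cvge0P => [r|e e0]; first exact: sup_ge0.
have e20 : 0 < e / 2 by rewrite divr_gt0.
move: hmod => /ge0_cvge0P-/(_ (fun r => sup_ge0 _) _ e20).
move=> /(@filter_ex _ _ _)[r hr].
set m := set_variation V (~` [set x | r < eucl_dist x 0]).
have mfin : m \is a fin_num.
  rewrite ge0_fin_numE ?measure_ge0//.
  by apply: lbv_bounded_variation; exact: bounded_borel_eucl_ball.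
(* [s] is chosen after [r] and before [y], which makes the estimate uniform in [y]. *)
near=> s.
have s0 : 0 < s by near: s; exact: nbhs_pinfty_gt.
apply: ge_ereal_sup => _ [y _ <-].
apply: (le_trans (integral_inv_eucl_dist_le _ V y r s s0)).
rewrite (splitr e) EFinD; apply: leeD.
  by apply: le_trans hr; apply: ereal_sup_ubound; exists y.
(* The requirement on [s] is [s >= (e / 2)^-1 * fine m], which is free of [y]. *)
by rewrite -/m -(fineK mfin) -EFinM lee_fin mulrC ler_pdivrMr// -ler_pdivrMl//.
Unshelve. all: by end_near.
Qed.
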